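(* For every integer $r \geq 2$, the $r$-dimensional butterfly network $BF(r)$ satisfies $$\operatorname{gp}(BF(r)) = 2^r + 2^{r-2}.$$
   Context: For a finite simple connected graph $G$, a geodesic (shortest path) between $x, y \in V(G)$ is an $x,y$-path of length $d_G(x,y)$, where $d_G$ is the usual graph distance. A set $S \subseteq V(G)$ is a general position set of $G$ if no three distinct vertices of $S$ lie on a common geodesic of $G$. The number $\operatorname{gp}(G)$ is the maximum cardinality of a general position set of $G$. For an integer $r\ge 1$, the $r$-dimensional butterfly network $BF(r)$ is the simple undirected graph with vertex set $\{[w,q] : w \in \{0,1,\dots,r\},\ q \in \{0,1\}^r\}$ (here $w$ is called the level of $[w,q]$). Two vertices $[w,q]$ and $[w',q']$ with $w' = w+1$ are adjacent if and only if either $q = q'$ or $q$ and $q'$ differ in exactly the $w'$-th bit (bits numbered $1,\dots,r$); there are no other edges. Thus $BF(r)$ has $r+1$ levels with $2^r$ vertices each and $r2^{r+1}$ edges. *)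

(* Defs.v *)
From mathcomp Require Import all_boot.

Set Implicit Arguments.
Unset Strict Implicit.
Unset Printing Implicit Defensive.

(* A finite graph is given by its adjacency relation. *)
Section GeneralPosition.
Variables (T : finType) (e : rel T).

(* The path visits x, then the entries of p in order; its length is size p. *)
Definition is_path (x y : T) (p : seq T) : bool :=
  [&& path e x p, last x p == y & uniq (x :: p)].

(* Every path has length < #|T|; dist x y is #|T| if x and y are not
   connected, which does not occur in a connected graph. *)
Definition dist (x y : T) : nat :=
  find (fun n => [exists p : n.-tuple T, is_path x y p]) (iota 0 #|T|).

(* The geodesics from x to y are the paths of length dist x y. *)
Definition general_position (S : {set T}) : bool :=
  [forall x : T, forall y : T, forall p : (dist x y).-tuple T,
    is_path x y p ==>
    [forall u in S, forall v in S, forall w in S,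
      uniq [:: u; v; w] ==>
      ~~ [&& u \in x :: p, v \in x :: p & w \in x :: p]]].

Definition gp : nat := \max_(S : {set T} | general_position S) #|S|.

End GeneralPosition.

Definition bf_vertex (r : nat) : finType := ('I_r.+1 * {ffun 'I_r -> bool})%type.

(* The indices i : 'I_r are 0-based: i stands for bit number i.+1. *)
Definition differ_exactly (r k : nat) (q q' : {ffun 'I_r -> bool}) : bool :=
  [forall i : 'I_r, (q i != q' i) == (i.+1 == k)].

Definition bf_up (r : nat) : rel (bf_vertex r) := fun a b =>
  (b.1 == a.1.+1 :> nat) && ((a.2 == b.2) || differ_exactly b.1 a.2 b.2).

Definition BF (r : nat) : rel (bf_vertex r) := fun a b =>
  bf_up a b || bf_up b a.
Arguments BF r : clear implicits.

Lemma BF_sym r : symmetric (BF r).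
Proof. by move=> a b; rewrite /BF orbC. Qed.

Lemma BF_irrefl r : irreflexive (BF r).
Proof. by move=> a; rewrite /BF /bf_up ltn_eqF. Qed.

(* Main.v *)
Require Import Defs.
From mathcomp Require Import all_boot.
From mathcomp Require Import zify.

(** Write r for the dimension. A shortest walk from [w,q] to [w',q'] must visit
    the levels w and w' and cross every level edge whose bit differs between q
    and q'. If those requirements span the levels from a to b, the walk
    covers the levels between w and w' once and the rest of the span twice, so
    the distance is 2(b - a) - |w - w'|. This formula is
    bf_dist; it is the graph distance because it vanishes only on the diagonal,
    grows by at most one along an edge, and strictly decreases along some edge
    at every other vertex. A set is then in general position exactly when no
    three of its vertices make the triangle inequality for bf_dist tight
    (general_position_certP, bf_general_positionP).

    Lower bound (large_set). Take the vertices of level 0 with last bit 0, those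
    of level r with first bit 0, and those of level 1 with both of these bits 1.
    Two vertices of level 0 agree in the last bit, so their geodesics stay below
    level r, and likewise two vertices of level r stay above level 0; geodesics
    between these two kinds are monotone in the level and have first and last
    bit 0 in between. A geodesic from level 0 or r to a chosen vertex of level 1
    spans all levels. In terms of distances: two different kinds are at constant
    distance, and within one kind the distance is ultrametric, up to a shift at
    level 1.

    Upper bound (gp_le). Fix all bits except the first and the last. The columns
    with these four bit patterns glue to a cycle of length 4r, embedded
    isometrically, in which the four vertices at positions 0, r, 2r, 3r are
    doubled (bf_dist_piece). If points of a cycle avoid common geodesics, no closed
    half contains three of them (cycle_gaps), so there are at most three positions
    (card_one_class), of which at most two are multiples of r
    (card_one_class_twins). With the doubling, each of the 2^(r-2) pieces
    contributes at most 3 + 2 = 5 vertices, and 5 * 2^(r-2) is the claim. *)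

Set Implicit Arguments.
Unset Strict Implicit.
Unset Printing Implicit Defensive.

(** * Certifying distances and general position *)

Section DistanceCertificate.
Variables (T : finType) (e : rel T) (f : T -> T -> nat).
Hypothesis f_eq0 : forall x y, (f x y == 0) = (x == y).
Hypothesis f_edge : forall x y z, e y z -> f x z <= (f x y).+1.
Hypothesis f_descent : forall x y, x != y -> exists2 z, e z y & f x z < f x y.

(** With a := x, this bounds the length of every path from below. *)
Lemma cert_path_le a x p : path e x p -> f a (last x p) <= f a x + size p.
Proof.
elim: p x => [|z p IH] x /=; first by rewrite addn0.
by case/andP=> xz /IH; have := f_edge a xz; lia.
Qed.

Lemma cert_refl x : f x x = 0.
Proof. by apply/eqP; rewrite f_eq0. Qed.

(** Following f_descent backwards from y reaches x in f x y steps, because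
    f_edge forbids a step that loses more than one. *)
Lemma cert_walk x y :
  exists p, [/\ path e x p, last x p = y & size p = f x y].
Proof.
have [n] := ubnP (f x y); elim: n y => // n IH y le_n.
have [->|neq_xy] := eqVneq x y; first by exists [::]; rewrite cert_refl.
have [z zy lt_zy] := f_descent neq_xy.
have [|p [xp lp sp]] := IH z; first by lia.
exists (rcons p y); rewrite rcons_path last_rcons size_rcons xp lp sp.
by split=> //; have := f_edge x zy; lia.
Qed.

Lemma cert_triangle x y z : f x z <= f x y + f y z.
Proof.
by have [p [yp <- <-]] := cert_walk y z; exact: cert_path_le.
Qed.

(** Shortcutting a repeated vertex would give a walk shorter than the
    certificate allows. *)
Lemma cert_walk_uniq x p :
  path e x p -> size p = f x (last x p) -> uniq (x :: p).
Proof.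
move=> xp; case/shortenP: (xp) => p' xp' up' sub_p' sp.
apply: leq_size_uniq up' _ _ => [z|/=].
  by rewrite !inE => /orP[->//|/sub_p' ->]; rewrite orbT.
by rewrite sp; have := cert_path_le x xp'; rewrite cert_refl.
Qed.

Lemma dist_cert x y : dist e x y = f x y.
Proof.
rewrite /dist; set P := (fun n => _).
have P_lb n : P n -> f x y <= n.
  case/existsP=> p /and3P[xp /eqP <- _].
  by have := cert_path_le x xp; rewrite cert_refl size_tuple.
have [p [xp lp sp]] := cert_walk x y.
have up : uniq (x :: p) by apply: cert_walk_uniq; rewrite ?lp.
have Pf : P (f x y).
  apply/existsP; exists (tcast sp (in_tuple p)).
  by rewrite /is_path val_tcast /= xp lp eqxx.
have f_lt : f x y < #|T|.
  by have := max_card (mem (x :: p)); rewrite (card_uniqP up) /= sp.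
have hasP : has P (iota 0 #|T|).
  by apply/hasP; exists (f x y); rewrite ?mem_iota.
apply/eqP; rewrite eqn_leq; apply/andP; split.
  rewrite leqNgt; apply/negP => /(before_find 0).
  by rewrite nth_iota // add0n Pf.
have := nth_find 0 hasP; rewrite nth_iota ?add0n; first exact: P_lb.
by rewrite -[X in _ < X](size_iota 0) -has_find.
Qed.

(** A shortcut between two vertices of a geodesic would shorten the whole. *)
Lemma cert_along_geodesic x p i j :
    path e x p -> size p = f x (last x p) -> i <= j <= size p ->
  f (nth x (x :: p) i) (nth x (x :: p) j) = j - i.
Proof.
move=> xp sp /andP[le_ij le_jp].
have le_sub a b : a <= b <= size p ->
    f (nth x (x :: p) a) (nth x (x :: p) b) <= b - a.
  elim: b => [|b IH]; first by rewrite leqn0 => /andP[/eqP-> _]; rewrite cert_refl.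
  rewrite leq_eqVlt => /andP[/predU1P[->|le_ab] lt_bp].
    by rewrite cert_refl.
  have := f_edge (nth x (x :: p) a) (pathP x xp b lt_bp).
  by have := IH; rewrite -ltnS le_ab /= => /(_ (ltnW lt_bp)); lia.
have := le_sub 0 i; have := le_sub i j; have := le_sub j (size p).
have := cert_triangle (nth x (x :: p) 0) (nth x (x :: p) i)
          (nth x (x :: p) (size p)).
have := cert_triangle (nth x (x :: p) i) (nth x (x :: p) j)
          (nth x (x :: p) (size p)).
rewrite -(last_nth x) -[nth x (x :: p) 0]/x -sp.
by lia.
Qed.

(** When the triangle inequality is tight, shortest walks from u to v and from
    v to w concatenate to a geodesic through all three; conversely, on a
    geodesic distances are differences of indices, so the middle one of three
    vertices makes the inequality tight. *)
Lemma general_position_certP (S : {set T}) :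
  reflect (forall u v w, u \in S -> v \in S -> w \in S -> uniq [:: u; v; w] ->
             f u v + f v w != f u w)
          (general_position e S).
Proof.
apply: (iffP idP) => [gpS u v w uS vS wS uvw|no_between].
  apply/negP => /eqP f_uvw.
  have [p [up lp sp]] := cert_walk u v; have [q [vq lq sq]] := cert_walk v w.
  have size_pq : size (p ++ q) = dist e u w.
    by rewrite dist_cert size_cat sp sq.
  have l_pq : last u (p ++ q) = w by rewrite last_cat lp.
  have path_pq : path e u (p ++ q) by rewrite cat_path up lp.
  move/forallP/(_ u)/forallP/(_ w)/forallP/(_ (tcast size_pq (in_tuple _))): gpS.
  rewrite /is_path val_tcast path_pq l_pq eqxx cert_walk_uniq ?l_pq //=; last first.
    by rewrite size_pq dist_cert.
  move/forall_inP/(_ u uS)/forall_inP/(_ v vS)/forall_inP/(_ w wS)/implyP/(_ uvw).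
  rewrite mem_head -{1}lp -{1}l_pq mem_last andbT /= -cat_cons mem_cat lp.
  by rewrite -{1}lp mem_last.
apply/forallP=> x; apply/forallP=> y; apply/forallP=> p.
apply/implyP=> /and3P[xp /eqP lp _].
have sp : size p = f x (last x p) by rewrite size_tuple lp dist_cert.
have ordered u v w : u \in S -> v \in S -> w \in S -> w \in x :: p ->
    index u (x :: p) < index v (x :: p) < index w (x :: p) ->
    False.
  move=> uS vS wS wp /andP[lt_uv lt_vw].
  have neq_idx a b : index a (x :: p) < index b (x :: p) -> a != b.
    by apply: contraTneq => ->; rewrite ltnn.
  have uvw : uniq [:: u; v; w].
    by rewrite /= !inE negb_or !neq_idx // (ltn_trans lt_uv).
  have lt_wp : index w (x :: p) <= size p by rewrite -ltnS -/(size (x :: p)) index_mem.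
  have vp : v \in x :: p by rewrite -index_mem (leq_trans lt_vw) // ltnW ?ltnS.
  have up : u \in x :: p by rewrite -index_mem (ltn_trans lt_uv) ?index_mem.
  have/negP[] := no_between u v w uS vS wS uvw.
  rewrite -[u](nth_index x up) -[v](nth_index x vp) -[w](nth_index x wp).
  have le_uv := ltnW lt_uv; have le_vw := ltnW lt_vw.
  rewrite !cert_along_geodesic ?le_uv ?le_vw ?(leq_trans le_vw) ?(leq_trans le_uv) //.
  by apply/eqP; lia.
apply/forall_inP=> u uS; apply/forall_inP=> v vS; apply/forall_inP=> w wS.
apply/implyP=> uvw; apply/negP=> /and3P[up vp wp].
have neq_idx a b : a \in x :: p -> b \in x :: p -> a != b ->
    index a (x :: p) != index b (x :: p).
  by move=> ap bp; apply: contra_neq => /(index_inj x ap bp).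
have [[neq_uv neq_uw] neq_vw] : (u != v) * (u != w) * (v != w).
  by move: uvw; rewrite /= !inE negb_or andbT => /andP[/andP[-> ->] ->].
have := neq_idx u v up vp neq_uv; have := neq_idx u w up wp neq_uw.
have := neq_idx v w vp wp neq_vw.
set a := index u _; set b := index v _; set c := index w _.
move=> neq_bc neq_ac neq_ab.
case: (ltngtP a b) neq_ab => // ab _; case: (ltngtP b c) neq_bc => // bc _;
case: (ltngtP a c) neq_ac => // ac _;
by [apply: (ordered u v w); rewrite // -/a -/b -/c ab
   | apply: (ordered u w v); rewrite // -/a -/b -/c ac
   | apply: (ordered v u w); rewrite // -/a -/b -/c ab
   | apply: (ordered v w u); rewrite // -/a -/b -/c bc
   | apply: (ordered w u v); rewrite // -/a -/b -/c ac
   | apply: (ordered w v u); rewrite // -/a -/b -/c bc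
   | clear -ab bc ac; lia].
Qed.

End DistanceCertificate.

(** * The distance of the butterfly network *)

Section ButterflyMetric.
Variable r : nat.
Implicit Types (q : {ffun 'I_r -> bool}) (x y z : bf_vertex r).

(** Bit i of the index type is flipped between the levels i and i.+1. Low levels
    are measured from the top, as r - level, so that the lower end of a span of
    levels is again a maximum with default value 0; lo_level is thus r minus the
    lowest level that a walk from x to y must visit. *)
Definition hi_bit q q' := \max_(i < r) (q i != q' i) * i.+1.
Definition lo_bit q q' := \max_(i < r) (q i != q' i) * (r - i).

Definition hi_level x y := maxn (maxn x.1 y.1) (hi_bit x.2 y.2).
Definition lo_level x y := maxn (maxn (r - x.1) (r - y.1)) (lo_bit x.2 y.2).

Definition bf_dist x y :=
  2 * (hi_level x y + lo_level x y - r) - ((x.1 - y.1) + (y.1 - x.1)).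

Lemma hi_bit_ge i q q' : q i != q' i -> i < hi_bit q q'.
Proof.
move=> qi; apply: leq_trans (leq_bigmax i) => /=.
by rewrite qi mul1n.
Qed.

Lemma lo_bit_ge i q q' : q i != q' i -> r - i <= lo_bit q q'.
Proof.
move=> qi; apply: leq_trans (leq_bigmax i) => /=.
by rewrite qi mul1n.
Qed.

Lemma hi_bit_leP q q' m :
  reflect (forall i, q i != q' i -> i < m) (hi_bit q q' <= m).
Proof.
apply: (iffP (bigmax_leqP _ _ _)) => [le_m i qi|le_m i _].
  by have := le_m i isT; rewrite qi mul1n.
by have := le_m i; case: (q i != q' i) => [/(_ isT)|_] //; rewrite mul1n.
Qed.

Lemma lo_bit_leP q q' m :
  reflect (forall i, q i != q' i -> r - i <= m) (lo_bit q q' <= m).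
Proof.
apply: (iffP (bigmax_leqP _ _ _)) => [le_m i qi|le_m i _].
  by have := le_m i isT; rewrite qi mul1n.
by have := le_m i; case: (q i != q' i) => [/(_ isT)|_] //; rewrite mul1n.
Qed.

Lemma hi_bit_le q q' : hi_bit q q' <= r.
Proof. by apply/hi_bit_leP. Qed.

Lemma lo_bit_le q q' : lo_bit q q' <= r.
Proof. by apply/lo_bit_leP=> i _; rewrite leq_subr. Qed.

Lemma hi_bitxx q : hi_bit q q = 0.
Proof.
by apply/eqP; rewrite -leqn0; apply/hi_bit_leP=> i; rewrite eqxx.
Qed.

Lemma lo_bitxx q : lo_bit q q = 0.
Proof.
by apply/eqP; rewrite -leqn0; apply/lo_bit_leP=> i; rewrite eqxx.
Qed.

(** The span of the differing bits reaches from level r - lo_bit to level hi_bit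
    and contains the level edge of at least one bit. *)
Lemma bit_span q q' : q != q' -> r < hi_bit q q' + lo_bit q q'.
Proof.
move=> neq_q; have [i qi]: exists i, q i != q' i.
  apply/existsP; rewrite -negb_forall; apply: contra neq_q => /forallP q_eq.
  by apply/eqP/ffunP=> i; apply/eqP.
have := hi_bit_ge qi; have := lo_bit_ge qi; have := ltn_ord i; lia.
Qed.

Lemma hi_bit_ultra q1 q2 q3 :
  hi_bit q1 q3 <= maxn (hi_bit q1 q2) (hi_bit q2 q3).
Proof.
apply/hi_bit_leP=> i q13; rewrite leq_max.
have [q12|/hi_bit_ge -> //] := eqVneq (q1 i) (q2 i).
by apply/orP; right; apply: hi_bit_ge; rewrite -q12.
Qed.

Lemma lo_bit_ultra q1 q2 q3 :
  lo_bit q1 q3 <= maxn (lo_bit q1 q2) (lo_bit q2 q3).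
Proof.
apply/lo_bit_leP=> i q13; rewrite leq_max.
have [q12|/lo_bit_ge -> //] := eqVneq (q1 i) (q2 i).
by apply/orP; right; apply: lo_bit_ge; rewrite -q12.
Qed.

Lemma bf_dist_eq0 x y : (bf_dist x y == 0) = (x == y).
Proof.
case: x y => [w q] [w' q']; rewrite /bf_dist /hi_level /lo_level xpair_eqE /=.
have := ltn_ord w; have := ltn_ord w'; rewrite -(inj_eq val_inj) /= => ltw ltw'.
have [->|/bit_span] := eqVneq q q'; last by lia.
by rewrite hi_bitxx lo_bitxx; lia.
Qed.

Lemma bf_upP y z :
  reflect [/\ z.1 = y.1.+1 :> nat & forall i : 'I_r, i != y.1 :> nat -> y.2 i = z.2 i]
          (bf_up y z).
Proof.
rewrite /bf_up; apply: (iffP andP) => [[/eqP zy diff]|[zy eq_q]]; split=> //.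
- move=> i iy; case/orP: diff => [/eqP -> //|/forallP/(_ i)].
  by rewrite zy eqSS (negPf iy) => /eqP/negbFE/eqP.
- by apply/eqP.
have [//|neq_q] := eqVneq y.2 z.2; apply/forallP=> i /=; rewrite zy eqSS.
have [iy|/eq_q ->] := eqVneq (i : nat) y.1; last by rewrite eqxx.
rewrite eqb_id; apply: contra_neq neq_q => eq_i.
apply/ffunP=> j; have [jy|/eq_q //] := eqVneq (j : nat) y.1.
by have -> : j = i by apply: val_inj; rewrite /= jy.
Qed.

(** An edge at level j touches bit j only, so its two ends share the
    contributions h and l of the other bits; and these never have the value
    that bit j contributes, which decides the descent steps where bit j is the
    outermost one to be repaired. *)
Lemma hi_lo_bits_up y z : bf_up y z ->
  exists2 j : 'I_r, j = y.1 :> nat &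
  forall q, exists h l, [/\ h != j.+1, l != r - j,
    hi_bit q y.2 = maxn ((q j != y.2 j) * j.+1) h /\
      hi_bit q z.2 = maxn ((q j != z.2 j) * j.+1) h &
    lo_bit q y.2 = maxn ((q j != y.2 j) * (r - j)) l /\
      lo_bit q z.2 = maxn ((q j != z.2 j) * (r - j)) l].
Proof.
case/bf_upP=> zy eq_q; have lt_yr : y.1 < r by rewrite -ltnS -zy.
exists (Ordinal lt_yr) => // q; set j := Ordinal lt_yr.
have neq_j i : i != j -> y.2 i = z.2 i by move=> ij; apply: eq_q.
exists (\max_(i < r | i != j) (q i != y.2 i) * i.+1).
exists (\max_(i < r | i != j) (q i != y.2 i) * (r - i)).
split.
- elim/big_ind: _ => // [m n|i]; first by rewrite /maxn; case: ifP.
  move=> ij; have {ij}: (i : nat) != y.1 by [].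
  by rewrite /=; case: (q i != _); lia.
- elim/big_ind: _ => [|m n|i]; first by rewrite eq_sym subn_eq0 -ltnNge.
    by rewrite /maxn; case: ifP.
  move=> ij; have {ij}: (i : nat) != y.1 by [].
  by have := lt_yr; have := ltn_ord i; rewrite /=; case: (q i != _); lia.
- split; rewrite /hi_bit (bigD1 j) //=; congr maxn.
  by apply: eq_bigr => i /neq_j ->.
split; rewrite /lo_bit (bigD1 j) //=; congr maxn.
by apply: eq_bigr => i /neq_j ->.
Qed.

Let edge_arith w k hy hz ly lz : k < r -> w <= r ->
    (w <= k -> [/\ ly = lz, hy <= hz <= hy.+1, k <= hy & r - w <= ly]) ->
    (k < w -> [/\ hy = hz, lz <= ly <= lz.+1, w <= hy & r - k.+1 <= lz]) ->
  (2 * (hz + lz - r) - ((w - k.+1) + (k.+1 - w)) <=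
     (2 * (hy + ly - r) - ((w - k) + (k - w))).+1) &&
  (2 * (hy + ly - r) - ((w - k) + (k - w)) <=
     (2 * (hz + lz - r) - ((w - k.+1) + (k.+1 - w))).+1).
Proof.
move=> lt_kr le_wr; have [le_wk /(_ isT)[-> ? ? ?] _|lt_kw _ /(_ isT)[-> ? ? ?]] := leqP w k.
  by lia.
by lia.
Qed.

(** If the edge lies above the level of x, lo_level is the same at both ends,
    hi_level differs by at most one and the level difference by exactly one; if
    it lies below, hi_level and lo_level are exchanged. In bf_dist the span counts
    twice and the level difference once, which leaves a change of one. *)
Lemma bf_dist_up x y z : bf_up y z ->
  (bf_dist x z <= (bf_dist x y).+1) && (bf_dist x y <= (bf_dist x z).+1).
Proof.
have := ltn_ord x.1; have := ltn_ord z.1 => ltz ltx yz.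
have [zy _] := bf_upP _ _ yz; have [j jy bits] := hi_lo_bits_up yz.
have {bits}[h [l [_ _ [hy hz] [ly lz]]]] := bits x.2.
rewrite /bf_dist /hi_level /lo_level hy hz ly lz zy jy.
move: (x.2 j != y.2 j) (x.2 j != z.2 j) => b b'.
rewrite {}zy ltnS in ltz; move: ltz ltx => {hy hz ly lz jy j yz}.
move: (y.1 : nat) (x.1 : nat) => k w ltk ltw {y z}.
have le_bit (c : bool) m : c * m <= m by case: c; lia.
have ble := le_bit b k.+1; have b'le := le_bit b' k.+1.
have lble := le_bit b (r - k); have lb'le := le_bit b' (r - k).
move: (b * k.+1) (b' * k.+1) (b * (r - k)) (b' * (r - k)) ble b'le lble lb'le.
move=> hb hb' lb lb' ble b'le lble lb'le {b b'}.
by apply: edge_arith ltk ltw _ _ => lt_wk; split; lia.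
Qed.

Lemma bf_dist_edge x y z : BF r y z -> bf_dist x z <= (bf_dist x y).+1.
Proof. by case/orP=> /(bf_dist_up x)/andP[]. Qed.

Lemma up_neighbour q y : y.1 < r ->
  exists2 z, bf_up y z & forall i : 'I_r, i = y.1 :> nat -> z.2 i = q i.
Proof.
move=> lt_yr.
exists (inord y.1.+1, [ffun i : 'I_r => if i == y.1 :> nat then q i else y.2 i]).
  apply/bf_upP; split=> [|i /negPf iy] /=; first by rewrite inordK.
  by rewrite ffunE iy.
by move=> i iy; rewrite ffunE iy eqxx.
Qed.

Lemma down_neighbour q y : 0 < y.1 ->
  exists2 z, bf_up z y & forall i : 'I_r, i = z.1 :> nat -> z.2 i = q i.
Proof.
move=> y_gt0; have lt_yr : y.1.-1 < r.+1 by have := ltn_ord y.1; lia.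
exists (inord y.1.-1, [ffun i : 'I_r => if i == y.1.-1 :> nat then q i else y.2 i]).
  apply/bf_upP; split=> [|i] /=; rewrite inordK // ?prednK //.
  by rewrite ffunE => /negPf ->.
by move=> i; rewrite /= inordK // ffunE => ->; rewrite eqxx.
Qed.

Let descent_arith d d' hy hz ly lz : 0 < hy + ly - r -> r + d <= hy + ly ->
    [\/ [/\ hz <= hy, lz <= ly & d < d'], [/\ hz < hy, lz <= ly & d <= d'.+1]
      | [/\ hz <= hy, lz < ly & d <= d'.+1]] ->
  2 * (hz + lz - r) - d' < 2 * (hy + ly - r) - d.
Proof. by move=> h_gt0 le_d [] []; lia. Qed.

(** The last step of a walk from x to y of minimal length. If some bit
    beyond y, seen from x, differs, that step comes back from there; otherwise it
    comes from the side of x. The neighbour of y gets the bit of x that lies on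
    the edge between them, which is right in every case. *)
Lemma bf_dist_descent x y :
  x != y -> exists2 z, BF r z y & bf_dist x z < bf_dist x y.
Proof.
rewrite -bf_dist_eq0 => dist_xy.
have := ltn_ord x.1; have := ltn_ord y.1; rewrite !ltnS => le_yr le_xr.
have le_hi := hi_bit_le x.2 y.2; have le_lo := lo_bit_le x.2 y.2.
have cases : [\/ x.1 <= y.1 < hi_bit x.2 y.2, y.1 <= x.1 /\ r - y.1 < lo_bit x.2 y.2,
  x.1 < y.1 /\ hi_bit x.2 y.2 <= y.1 | y.1 < x.1 /\ lo_bit x.2 y.2 <= r - y.1].
  move: dist_xy; rewrite /bf_dist /hi_level /lo_level.
  move: (hi_bit _ _) (lo_bit _ _) (x.1 : nat) (y.1 : nat) le_yr le_xr le_hi le_lo.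
  move=> h l w k le_kr le_wr le_hr le_lr dist_neq0.
  have [|not1] := boolP (w <= k < h); first by constructor 1.
  have [|not2] := boolP ((k <= w) && (r - k < l)).
    by case/andP; constructor 2.
  have [|not3] := boolP ((w < k) && (h <= k)).
    by case/andP; constructor 3.
  constructor 4; have [eq_wk|neq_wk] : w = k \/ w != k by lia.
    by exfalso; move: dist_neq0; rewrite eq_wk !maxnn; lia.
  by lia.
have up_case : y.1 < r ->
    (forall z, bf_up y z -> (forall i : 'I_r, i = y.1 :> nat -> z.2 i = x.2 i) ->
       bf_dist x z < bf_dist x y) ->
    exists2 z, BF r z y & bf_dist x z < bf_dist x y.
  move=> lt_yr closer; have [z yz zx] := up_neighbour x.2 lt_yr.
  by exists z; [rewrite /BF yz orbT | exact: closer].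
have down_case : 0 < y.1 ->
    (forall z, bf_up z y -> (forall i : 'I_r, i = z.1 :> nat -> z.2 i = x.2 i) ->
       bf_dist x z < bf_dist x y) ->
    exists2 z, BF r z y & bf_dist x z < bf_dist x y.
  move=> y_gt0 closer; have [z zy zx] := down_neighbour x.2 y_gt0.
  by exists z; [rewrite /BF zy | exact: closer].
have span_gt0 : 0 < hi_level x y + lo_level x y - r.
  by move: dist_xy; rewrite /bf_dist; lia.
have span_ge : r + ((x.1 - y.1) + (y.1 - x.1)) <= hi_level x y + lo_level x y.
  rewrite /hi_level /lo_level; move: (hi_bit _ _) (lo_bit _ _) => h l.
  by move: (x.1 : nat) (y.1 : nat) le_xr le_yr => w k; clear; lia.
case: cases.
- case/andP=> le_xy lt_y; apply: up_case => [|z yz zx]; first by lia.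
  have [zy _] := bf_upP _ _ yz; have [j jy bits] := hi_lo_bits_up yz.
  apply: descent_arith => //; constructor 1.
  have {bits}[h [l [neq_h neq_l [hy hz] [ly lz]]]] := bits x.2; move: lt_y neq_h neq_l.
  rewrite /hi_level /lo_level hy hz ly lz zx // eqxx zy !mul0n jy.
  move: (x.1 : nat) (y.1 : nat) (x.2 j != y.2 j) le_xy => w k b; clear => le_wk.
  by case: b; rewrite ?mul0n ?mul1n => lt_k neq_h neq_l; split; lia.
- case=> le_yx lt_y; apply: down_case => [|z zy zx]; first by lia.
  have [yz _] := bf_upP _ _ zy; have [j jz bits] := hi_lo_bits_up zy.
  apply: descent_arith => //; constructor 1.
  have {bits}[h [l [neq_h neq_l [hz hy] [lz ly]]]] := bits x.2; move: lt_y neq_h neq_l.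
  rewrite /hi_level /lo_level hy hz ly lz zx // eqxx yz !mul0n jz.
  move: le_xr le_yx le_yr; rewrite yz.
  move: (x.1 : nat) (z.1 : nat) (x.2 j != y.2 j) => w k b; clear => le_wr le_kw le_kr.
  by case: b; rewrite ?mul0n ?mul1n => lt_k neq_h neq_l; split; lia.
- case=> lt_xy le_y; apply: down_case => [|z zy zx]; first by lia.
  have [yz _] := bf_upP _ _ zy; have [j jz bits] := hi_lo_bits_up zy.
  apply: descent_arith => //; constructor 2.
  have {bits}[h [l [neq_h neq_l [hz hy] [lz ly]]]] := bits x.2; move: le_y neq_h neq_l.
  rewrite /hi_level /lo_level hy hz ly lz zx // eqxx yz !mul0n jz.
  move: le_xr lt_xy le_yr; rewrite yz.
  move: (x.1 : nat) (z.1 : nat) (x.2 j != y.2 j) => w k b; clear => le_wr lt_wk le_kr.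
  by case: b; rewrite ?mul0n ?mul1n => le_k neq_h neq_l; split; lia.
case=> lt_yx le_y; apply: up_case => [|z yz zx]; first by lia.
have [zy _] := bf_upP _ _ yz; have [j jy bits] := hi_lo_bits_up yz.
apply: descent_arith => //; constructor 3.
have {bits}[h [l [neq_h neq_l [hy hz] [ly lz]]]] := bits x.2; move: le_y neq_h neq_l.
rewrite /hi_level /lo_level hy hz ly lz zx // eqxx zy !mul0n jy.
move: (x.1 : nat) (y.1 : nat) (x.2 j != y.2 j) lt_yx le_xr => w k b; clear => lt_kw le_wr.
by case: b; rewrite ?mul0n ?mul1n => le_k neq_h neq_l; split; lia.
Qed.

End ButterflyMetric.

(** * A large set in general position *)

Section ButterflyGeneralPosition.
Variable n : nat.
Local Notation r := n.+2.
Implicit Types (q : {ffun 'I_r -> bool}) (x y z : bf_vertex r).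

Definition bf_general_positionP (S : {set bf_vertex r}) :=
  general_position_certP (@bf_dist_eq0 r) (@bf_dist_edge r) (@bf_dist_descent r) S.

Lemma hi_bit_last q q' : q ord_max != q' ord_max -> hi_bit q q' = r.
Proof. by move=> neq; have := hi_bit_le q q'; have /= := hi_bit_ge neq; lia. Qed.

Lemma lo_bit_first q q' : q ord0 != q' ord0 -> lo_bit q q' = r.
Proof. by move=> neq; have := lo_bit_le q q'; have /= := lo_bit_ge neq; lia. Qed.

Lemma hi_bit_lt q q' : q ord_max = q' ord_max -> hi_bit q q' < r.
Proof.
move=> eq_last; rewrite ltnS; apply/hi_bit_leP=> i qi.
have : i != ord_max by apply: contraNneq qi => ->; rewrite eq_last.
by rewrite -val_eqE /=; have := ltn_ord i; lia.
Qed.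

Lemma lo_bit_lt q q' : q ord0 = q' ord0 -> lo_bit q q' < r.
Proof.
move=> eq_first; rewrite ltnS; apply/lo_bit_leP=> i qi.
have : i != ord0 by apply: contraNneq qi => ->; rewrite eq_first.
by rewrite -val_eqE /=; have := ltn_ord i; lia.
Qed.

Definition bottom_half : {set bf_vertex r} :=
  setX [set ord0] [set q : {ffun _} | ~~ q ord_max].
Definition top_half : {set bf_vertex r} :=
  setX [set ord_max] [set q : {ffun _} | ~~ q ord0].
Definition level1_quarter : {set bf_vertex r} :=
  setX [set inord 1] [set q : {ffun _} | q ord0 && q ord_max].
Definition large_set := bottom_half :|: top_half :|: level1_quarter.

Lemma large_setP x : x \in large_set ->
  [\/ x.1 = 0 :> nat /\ ~~ x.2 ord_max, x.1 = r :> nat /\ ~~ x.2 ord0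
    | x.1 = 1 :> nat /\ x.2 ord0 && x.2 ord_max].
Proof.
by case: x => w q; rewrite !inE /= => /orP[/orP[]|] /andP[/eqP-> ?];
  [constructor 1|constructor 2|constructor 3; rewrite inordK].
Qed.

(** Distances in large_set depend on the differing bits only within a level.
    The arguments w and w' are levels of large_set, hence 0, 1 or r. *)
Definition large_set_dist (w w' h l : nat) :=
  match w, w' with
  | 0, 0 => 2 * h
  | 0, 1 | 1, 0 => 2 * r - 1
  | 0, _ | _, 0 => r
  | 1, 1 => 2 * h - 2
  | 1, _ | _, 1 => r.+1
  | _, _ => 2 * l
  end.

Lemma bf_dist_large_set x y : x \in large_set -> y \in large_set ->
  let h := hi_bit x.2 y.2 in let l := lo_bit x.2 y.2 in
  [/\ bf_dist x y = large_set_dist x.1 y.1 h l,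
      x.1 < 2 -> y.1 < 2 -> x.1 = y.1 :> nat -> h < r &
      x.1 = r :> nat -> y.1 = r :> nat -> l < r].
Proof.
move=> xS yS h l.
have last_neq : x.2 ord_max != y.2 ord_max -> h = r by exact: hi_bit_last.
have last_eq : x.2 ord_max = y.2 ord_max -> h < r by exact: hi_bit_lt.
have first_neq : x.2 ord0 != y.2 ord0 -> l = r by exact: lo_bit_first.
have first_eq : x.2 ord0 = y.2 ord0 -> l < r by exact: lo_bit_lt.
have le_h : h <= r := hi_bit_le _ _; have le_l : l <= r := lo_bit_le _ _.
rewrite /bf_dist /hi_level /lo_level -/h -/l.
move: h l last_neq last_eq first_neq first_eq le_h le_l => h l.
case/large_setP: xS => -[-> xb]; case/large_setP: yS => -[-> yb]; move: xb yb.
all: case: (x.2 ord0) (y.2 ord0) (x.2 ord_max) (y.2 ord_max) => [] [] [] [] //= _ _.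
(* The first and the last bits are now concrete: each of the four implications
   on h and l either fires or has a false premise. *)
all: move=> A B C D E F; try have A' := A isT; try have B' := B erefl.
all: try have C' := C isT; try have D' := D erefl; clear A B C D.
all: by split; lia.
Qed.

(** Betweenness of v would need equality in the triangle inequality. If v shares
    its kind with u or w but not with both, positivity excludes it; if all kinds
    agree, the ultrametric inequalities of hi_bit and lo_bit do; if v has a kind
    of its own, the detour through v is too long. *)
Lemma large_set_general_position : general_position (BF r) large_set.
Proof.
apply/bf_general_positionP => u v w uS vS wS.
rewrite /= !inE negb_or andbT => /andP[/andP[neq_uv neq_uw] neq_vw].
move: (bf_dist_eq0 u v) (bf_dist_eq0 v w).
rewrite (negPf neq_uv) (negPf neq_vw).
have [-> _ _] := bf_dist_large_set uS vS.
have [-> _ _] := bf_dist_large_set vS wS.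
have [-> h_lt l_lt] := bf_dist_large_set uS wS.
move: h_lt l_lt (hi_bit_ultra u.2 v.2 w.2) (lo_bit_ultra u.2 v.2 w.2).
move: (hi_bit u.2 v.2) (hi_bit u.2 w.2) (hi_bit v.2 w.2) => huv huw hvw.
move: (lo_bit u.2 v.2) (lo_bit u.2 w.2) (lo_bit v.2 w.2) => luv luw lvw.
by case/large_setP: uS => -[-> _]; case/large_setP: vS => -[-> _];
   case/large_setP: wS => -[-> _] /=; lia.
Qed.

Lemma card_fixed_bits (P : {set 'I_r}) (g : 'I_r -> bool) :
  #|[set q : {ffun 'I_r -> bool} | [forall i in P, q i == g i]]| = 2 ^ (r - #|P|).
Proof.
pose F i : pred bool := if i \in P then pred1 (g i) else predT.
have -> : #|[set q : {ffun 'I_r -> bool} | [forall i in P, q i == g i]]| = #|family F|.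
  rewrite cardsE; apply: eq_card => q; rewrite !inE.
  apply/forall_inP/familyP => [qP i|qF i iP].
    by rewrite /F; case: ifP => // /qP.
  by have := qF i; rewrite /F iP.
rewrite card_family foldrE big_map big_enum /= (bigID [in P]) /=.
rewrite big1 ?mul1n => [|i iP]; last by rewrite /F iP card1.
rewrite (eq_bigr (fun=> 2)) => [|i /negPf iP]; last by rewrite /F iP card_bool.
by rewrite prod_nat_const -[X in X - _](card_ord r) -(cardC P) addKn.
Qed.

Lemma card_bit_off i : #|[set q : {ffun 'I_r -> bool} | ~~ q i]| = 2 ^ n.+1.
Proof.
have := card_fixed_bits [set i] xpred0; rewrite cards1 subn1 => <-.
apply: eq_card => q; rewrite !inE; apply/idP/forall_inP => [qi j|/(_ i)].
  by rewrite inE => /eqP->; rewrite eqbF_neg.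
by rewrite inE eqxx eqbF_neg => ->.
Qed.

Lemma card_ends_bits (b : bool) :
  #|[set q : {ffun 'I_r -> bool} | (q ord0 == b) && (q ord_max == b)]| = 2 ^ n.
Proof.
have := card_fixed_bits [set ord0; ord_max] (fun=> b).
rewrite cards2 /= subn2 /= => <-.
apply: eq_card => q; rewrite !inE; apply/idP/forall_inP => [/andP[q0 qmax] j|qb].
  by rewrite !inE => /orP[] /eqP->.
by rewrite !qb // !inE eqxx ?orbT.
Qed.

Lemma card_large_set : #|large_set| = 2 ^ r + 2 ^ (r - 2).
Proof.
have disj_levels (i j : 'I_r.+1) (A B : {set {ffun 'I_r -> bool}}) :
    (i : nat) != j -> setX [set i] A :&: setX [set j] B = set0.
  move=> neq_ij; apply/setP=> -[w q]; rewrite !inE /=.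
  by have [->|//] := eqVneq w i; rewrite -val_eqE (negPf neq_ij) andbF.
rewrite cardsU cardsU setIUl !disj_levels ?inordK // setU0 cards0 !subn0.
rewrite !cardsX !cards1 !mul1n !card_bit_off.
have -> : #|[set q : {ffun 'I_r -> bool} | q ord0 && q ord_max]| = 2 ^ n.
  by rewrite -(card_ends_bits true); apply: eq_card => q; rewrite !inE !eqb_id.
by rewrite subn2 addnn -mul2n -expnS.
Qed.

(** * Decomposition into doubled cycles *)

(** The fibres of middle_bits on the second component are the pieces of the
    upper bound. *)
Definition middle_bits q : {ffun 'I_r -> bool} :=
  [ffun i => (i != ord0) && (i != ord_max) && q i].

Lemma middle_bits_eqP q q' : middle_bits q = middle_bits q' ->
  forall i, i != ord0 -> i != ord_max -> q i = q' i.
Proof.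
by move=> /ffunP eq_mid i i0 imax; have := eq_mid i; rewrite !ffunE i0 imax.
Qed.

Lemma hi_bit_piece q q' : middle_bits q = middle_bits q' ->
  hi_bit q q' = if q ord_max != q' ord_max then r else q ord0 != q' ord0.
Proof.
move=> /middle_bits_eqP eq_mid; case: ifP => [/hi_bit_last //|/negbFE/eqP eq_last].
apply/eqP; rewrite eqn_leq; apply/andP; split.
  apply/hi_bit_leP=> i qi; have [i0|i0] := eqVneq i ord0.
    by rewrite -i0 qi i0.
  have [imax|imax] := eqVneq i ord_max; first by rewrite imax eq_last eqxx in qi.
  by rewrite eq_mid ?eqxx in qi.
by have [//|/hi_bit_ge] := eqVneq (q ord0) (q' ord0).
Qed.

Lemma lo_bit_piece q q' : middle_bits q = middle_bits q' ->
  lo_bit q q' = if q ord0 != q' ord0 then r else q ord_max != q' ord_max.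
Proof.
move=> /middle_bits_eqP eq_mid; case: ifP => [/lo_bit_first //|/negbFE/eqP eq_first].
apply/eqP; rewrite eqn_leq; apply/andP; split.
  apply/lo_bit_leP=> i qi; have [imax|imax] := eqVneq i ord_max.
    by rewrite -imax qi imax /= subSnn.
  have [i0|i0] := eqVneq i ord0; first by rewrite i0 eq_first eqxx in qi.
  by rewrite eq_mid ?eqxx in qi.
have [//|/lo_bit_ge] := eqVneq (q ord_max) (q' ord_max).
by rewrite /= subSnn.
Qed.

(** Going around the cycle, the columns with (first bit, last bit) equal to
    (0,0), (0,1), (1,1), (1,0) are traversed up, down, up, down. Consecutive
    columns meet at level r, 0, r and 0 in turn, where two vertices with the same
    neighbours in the piece share a position. The case x.1 = 0 of the column
    (1,0) is position 4 * r, read modulo 4 * r. *)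
Definition cycle_pos x : nat :=
  match x.2 ord0, x.2 ord_max with
  | false, false => x.1
  | false, true => 2 * r - x.1
  | true, true => 2 * r + x.1
  | true, false => if x.1 == ord0 then 0 else 4 * r - x.1
  end.

Definition cycle_dist a b := minn ((a - b) + (b - a)) (4 * r - ((a - b) + (b - a))).

(** The piece is isometric to the cycle because a shortest walk between vertices
    with equal middle bits need not flip any of them. Two distinct vertices that
    share a position are at distance 2. *)
Lemma bf_dist_piece x y : middle_bits x.2 = middle_bits y.2 ->
  cycle_pos x != cycle_pos y -> bf_dist x y = cycle_dist (cycle_pos x) (cycle_pos y).
Proof.
move=> eq_mid; have := ltn_ord x.1; have := ltn_ord y.1.
rewrite /bf_dist /hi_level /lo_level hi_bit_piece // lo_bit_piece // /cycle_pos /cycle_dist.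
rewrite -!val_eqE /= !ltnS; move: (x.1 : nat) (y.1 : nat) => w w'.
move=> le_w' le_w.
have extremes : exists a b, [/\ maxn w w' = b, maxn (r - w) (r - w') = r - a,
    w - w' + (w' - w) = b - a, w + w' = a + b & a <= b <= r].
  have [le_ww|/ltnW le_ww] := leqP w w'.
    by exists w, w'; rewrite (maxn_idPl (leq_sub2l r le_ww)); split; lia.
  by exists w', w; rewrite (maxn_idPr (leq_sub2l r le_ww)); split; lia.
have {extremes}[a [b [-> -> def_d def_s le_abr]]] := extremes; rewrite def_d.
have [le_ab le_br] := andP le_abr; have le_ar := leq_trans le_ab le_br.
(* The four values of the distance, named after which of the two free bits
   differ; 2 is the value at a pair of vertices sharing a position. *)
have both : 2 * (r + r - r) - (b - a) = 2 * r - (b - a) by rewrite addnK.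
have none : 2 * (b + (r - a) - r) - (b - a) = b - a.
  by clear -le_ab le_ar; lia.
have first : 2 * (maxn b 1 + r - r) - (b - a) = if b == 0 then 2 else a + b.
  by rewrite addnK; clear -le_ab; case: eqP => [->|]; lia.
have last : 2 * (r + maxn (r - a) 1 - r) - (b - a) =
    if a == r then 2 else 2 * r - (a + b).
  by rewrite addKn; clear -le_ab le_br; case: eqP => [->|]; lia.
move/eqP; case: (x.2 ord0) (x.2 ord_max) (y.2 ord0) (y.2 ord_max) => [] [] [] [] /=.
all: rewrite ?(maxn_idPr le_br) ?(maxn_idPr (leq_subr a r)) ?maxn0.
all: rewrite ?both ?none ?first ?last; clear both none first last.
all: by repeat case: eqP => ?; lia.
Qed.

(** One vertex of each pair that shares a position, so that positions are
    injective on both second_twin and its complement. *)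
Definition second_twin x : bool :=
  ((x.1 : nat) == 0) && x.2 ord0 || ((x.1 : nat) == r) && x.2 ord_max.

Lemma cycle_pos_inj x y : middle_bits x.2 = middle_bits y.2 ->
  second_twin x = second_twin y -> cycle_pos x = cycle_pos y -> x = y.
Proof.
case: x y => [w q] [w' q'] /= /middle_bits_eqP eq_mid.
have := ltn_ord w; have := ltn_ord w'; rewrite /second_twin /cycle_pos /= -!val_eqE /=.
move=> lt_w' lt_w eq_twin eq_pos.
have [eq_w eq0 eqmax] : [/\ w = w' :> nat, q ord0 = q' ord0 & q ord_max = q' ord_max].
  move: (w : nat) (w' : nat) lt_w lt_w' eq_twin eq_pos => k k' {w w' eq_mid}.
  case: (q ord0) (q ord_max) (q' ord0) (q' ord_max) => [] [] [] [] /= lt_w lt_w';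
    rewrite ?andbT ?andbF ?orbF ?orFb; by repeat case: eqP => ?; split; lia.
have -> : w = w' by apply: ord_inj.
suff -> : q = q' by [].
apply/ffunP=> i; have [->//|i0] := eqVneq i ord0.
by have [->//|imax] := eqVneq i ord_max; exact: eq_mid.
Qed.

Lemma cycle_pos_lt x : cycle_pos x < 4 * r.
Proof.
rewrite /cycle_pos -val_eqE /=; have := ltn_ord x.1; move: (x.1 : nat) => w.
by case: (x.2 ord0) (x.2 ord_max) => [] []; try case: eqP; lia.
Qed.

Lemma second_twin_pos x : second_twin x -> r %| cycle_pos x.
Proof.
rewrite /second_twin /cycle_pos -val_eqE /=.
case: (x.2 ord0) (x.2 ord_max) => [] []; rewrite ?andbT ?andbF ?orbF //=.
- by case/orP=> /eqP ->; [rewrite addn0 dvdn_mull | rewrite dvdn_addr // dvdn_mull].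
- by move=> /eqP->.
by move=> /eqP->; rewrite mul2n -addnn addnK.
Qed.

(** Three points in a closed half of the cycle lie on an arc that is a geodesic
    through the middle one; so each of the three gaps is shorter than 2 * r. *)
Lemma cycle_gaps (S : {set bf_vertex r}) x y z : general_position (BF r) S ->
    x \in S -> y \in S -> z \in S ->
    middle_bits x.2 = middle_bits y.2 -> middle_bits y.2 = middle_bits z.2 ->
    cycle_pos x < cycle_pos y < cycle_pos z ->
  [/\ cycle_pos y < cycle_pos x + 2 * r, cycle_pos z < cycle_pos y + 2 * r &
      cycle_pos x + 2 * r < cycle_pos z].
Proof.
move=> /bf_general_positionP no_between xS yS zS eq_xy eq_yz /andP[lt_xy lt_yz].
have lt_xz := ltn_trans lt_xy lt_yz.
have neq u v : cycle_pos u < cycle_pos v -> (u != v) * (v != u).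
  move=> lt_uv; have neq_uv : u != v by apply: contraTneq lt_uv => ->; rewrite ltnn.
  by rewrite neq_uv eq_sym neq_uv.
have uniq3 (u v w : bf_vertex r) : u != v -> u != w -> v != w -> uniq [:: u; v; w].
  by move=> uv uw vw; rewrite /= !inE negb_or uv uw vw.
have lt_z := cycle_pos_lt z.
have bet u v w uS vS wS uv uw vw := no_between u v w uS vS wS (uniq3 u v w uv uw vw).
have d u v : middle_bits u.2 = middle_bits v.2 ->
    cycle_pos u < cycle_pos v -> bf_dist u v = cycle_dist (cycle_pos u) (cycle_pos v).
  by move=> eq_uv lt_uv; apply: bf_dist_piece; rewrite // ltn_eqF.
have d' u v : middle_bits u.2 = middle_bits v.2 ->
    cycle_pos u < cycle_pos v -> bf_dist v u = cycle_dist (cycle_pos v) (cycle_pos u).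
  by move=> eq_uv lt_uv; apply: bf_dist_piece; rewrite // gtn_eqF.
have eq_xz := etrans eq_xy eq_yz.
have := bet x y z xS yS zS (neq _ _ lt_xy).1 (neq _ _ lt_xz).1 (neq _ _ lt_yz).1.
have := bet y z x yS zS xS (neq _ _ lt_yz).1 (neq _ _ lt_xy).2 (neq _ _ lt_xz).2.
have := bet z x y zS xS yS (neq _ _ lt_xz).2 (neq _ _ lt_yz).2 (neq _ _ lt_xy).1.
rewrite (d _ _ eq_xy lt_xy) (d _ _ eq_yz lt_yz) (d _ _ eq_xz lt_xz).
rewrite (d' _ _ eq_xy lt_xy) (d' _ _ eq_yz lt_yz) (d' _ _ eq_xz lt_xz).
move: (cycle_pos x) (cycle_pos y) (cycle_pos z) lt_xy lt_yz lt_z => a b c.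
rewrite /cycle_dist; clear => lt_ab lt_bc lt_c A B C; split.
- by clear A C; lia.
- by clear B C; lia.
by clear A B; lia.
Qed.

Section OneClass.
Variables (S : {set bf_vertex r}) (B : {set bf_vertex r}).
Hypothesis gpS : general_position (BF r) S.
Hypothesis sBS : B \subset S.
Hypothesis B_mid : {in B &, forall x y, middle_bits x.2 = middle_bits y.2}.
Hypothesis B_inj : {in B &, injective cycle_pos}.

Let sorted_positions : exists2 s : seq nat, sorted ltn s /\ size s = #|B| &
  forall a, a \in s -> exists2 x, x \in B & a = cycle_pos x.
Proof.
exists (sort leq [seq cycle_pos x | x in B]).
  rewrite size_sort size_map -cardE ltn_sorted_uniq_leq sort_uniq.
  rewrite (sort_sorted leq_total) andbT map_inj_in_uniq ?enum_uniq //.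
  by move=> x y; rewrite !mem_enum; apply: B_inj.
move=> a; rewrite mem_sort => /mapP[x]; rewrite mem_enum.
by exists x.
Qed.

Let gaps x y z : x \in B -> y \in B -> z \in B ->
    cycle_pos x < cycle_pos y < cycle_pos z ->
  [/\ cycle_pos y < cycle_pos x + 2 * r, cycle_pos z < cycle_pos y + 2 * r &
      cycle_pos x + 2 * r < cycle_pos z].
Proof.
move=> xB yB zB; have inS := subsetP sBS.
by apply: (cycle_gaps gpS); rewrite ?inS //; apply: B_mid.
Qed.

(** With four positions a < b < c < d, the triple a, b, c forces c to be more
    than half a turn after a, and the triple a, c, d forces less. *)
Lemma card_one_class : #|B| <= 3.
Proof.
have [s [s_lt <-] sB] := sorted_positions.
case: s s_lt sB => [|a [|b [|c [|d s]]]] //= /and4P[ab bc cd _] sB.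
have [x xB ax] : exists2 x, x \in B & a = cycle_pos x by apply: sB; rewrite !inE eqxx.
have [y yB by_] : exists2 y, y \in B & b = cycle_pos y by apply: sB; rewrite !inE eqxx orbT.
have [z zB cz] : exists2 z, z \in B & c = cycle_pos z by apply: sB; rewrite !inE eqxx !orbT.
have [t tB dt] : exists2 t, t \in B & d = cycle_pos t by apply: sB; rewrite !inE eqxx !orbT.
rewrite {}ax {}by_ {}cz {}dt in ab bc cd.
have [_ _ lt_xz] : [/\ _, _ & _] := gaps xB yB zB (introT andP (conj ab bc)).
have [] := gaps xB zB tB (introT andP (conj (ltn_trans ab bc) cd)).
by rewrite ltnNge ltnW.
Qed.

(** Three multiples of r with gaps below 2 * r have all gaps equal to r, but the
    gaps must sum to 4 * r. *)
Lemma card_one_class_twins : {in B, forall x, r %| cycle_pos x} -> #|B| <= 2.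
Proof.
move=> B_dvd; have [s [s_lt <-] sB] := sorted_positions.
case: s s_lt sB => [|a [|b [|c s]]] //= /and3P[ab bc _] sB.
have [x xB ax] : exists2 x, x \in B & a = cycle_pos x by apply: sB; rewrite !inE eqxx.
have [y yB by_] : exists2 y, y \in B & b = cycle_pos y by apply: sB; rewrite !inE eqxx orbT.
have [z zB cz] : exists2 z, z \in B & c = cycle_pos z by apply: sB; rewrite !inE eqxx !orbT.
rewrite {}ax {}by_ {}cz in ab bc.
have := gaps xB yB zB (introT andP (conj ab bc)); move: ab bc.
have [/dvdnP[i ->] /dvdnP[j ->] /dvdnP[k ->]] := And3 (B_dvd x xB) (B_dvd y yB) (B_dvd z zB).
rewrite -!mulnDl !ltn_mul2r /=.
by move=> ? ? []; lia.
Qed.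

End OneClass.

Lemma gp_le S : general_position (BF r) S -> #|S| <= 2 ^ r + 2 ^ (r - 2).
Proof.
move=> gpS.
pose M := [set q : {ffun 'I_r -> bool} | (q ord0 == false) && (q ord_max == false)].
have mid_M x : x \in S -> middle_bits x.2 \in M.
  by rewrite inE !ffunE !eqxx /= ?andbF.
rewrite -sum1_card (partition_big (fun x => middle_bits x.2) (mem M)) //=.
have -> : 2 ^ r + 2 ^ (r - 2) = \sum_(q in M) 5.
  by rewrite sum_nat_const card_ends_bits subn2 /= !expnS; lia.
apply: leq_sum => q _; rewrite sum1dep_card.
set A := [set _ | _].
have A_sub : A \subset S by apply/subsetP=> x; rewrite inE => /andP[].
have A_mid : {in A &, forall x y, middle_bits x.2 = middle_bits y.2}.
  by move=> x y; rewrite !inE => /andP[_ /eqP->] /andP[_ /eqP->].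
rewrite -(cardsID [set x | second_twin x] A) -[5]/(2 + 3); apply: leq_add.
  have sub : A :&: [set x | second_twin x] \subset A by apply: subsetIl.
  apply: (card_one_class_twins gpS (subset_trans sub A_sub)).
  - by move=> x y /(subsetP sub) xA /(subsetP sub) yA; apply: A_mid.
  - move=> x y /setIP[xA]; rewrite inE => xt /setIP[yA]; rewrite inE => yt.
    by apply: cycle_pos_inj; [exact: A_mid | rewrite xt yt].
  by move=> x /setIP[_]; rewrite inE; exact: second_twin_pos.
have sub : A :\: [set x | second_twin x] \subset A by apply: subsetDl.
apply: (card_one_class gpS (subset_trans sub A_sub)).
  by move=> x y /(subsetP sub) xA /(subsetP sub) yA; apply: A_mid.
move=> x y /setDP[xA]; rewrite inE => /negPf xt /setDP[yA]; rewrite inE => /negPf yt.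
by apply: cycle_pos_inj; [exact: A_mid | rewrite xt yt].
Qed.

End ButterflyGeneralPosition.

Theorem theorem2p4 (r : nat) (hr : 2 <= r) : gp (BF r) = 2 ^ r + 2 ^ (r - 2).
Proof.
case: r hr => [|[|n]] // _; apply/eqP; rewrite eqn_leq; apply/andP; split.
  by apply/bigmax_leqP=> S; exact: gp_le.
rewrite -card_large_set.
exact: (leq_bigmax_cond _ (large_set_general_position n)).
Qed.
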